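(* Let $G$ be a graph of order $n$. Then $\lambda^-(G)=n-1$ if and only if $G$ consists of (i.e. is the disjoint union of) a (possibly empty) two-set perfectly orderable graph and an isolated vertex. Also, $\lambda^-(G)\le n-1$ for every graph $G$.
   Context: Graphs are finite, simple (no loops or multiple edges), undirected; $n=|V(G)|$ is the order of $G$ (at least 1). Skew zero forcing: a subset $S\subseteq V(G)$ (possibly empty) is colored blue and all other vertices white. Skew color change rule: if any vertex (blue or white) has exactly one white neighbor, then that white neighbor becomes blue. $S$ is a skew zero forcing set if repeated application of the rule eventually turns all vertices blue. The skew zero forcing span $\lambda^-(G)$ is the number of distinct cardinalities $k$ for which there exist $Z,F\subseteq V(G)$ with $|Z|=|F|=k$ such that $Z$ is a skew zero forcing set and $F$ is not a skew zero forcing set. A graph $G$ is two-set perfectly orderable if (1) $V(G)$ can be partitioned into ordered sets $U=\{u_1,\ldots,u_m\}$ and $W=\{w_1,\ldots,w_m\}$ such that $u_i v\in E(G)$ only if $v=w_j$ for some $j\le i$, and (2) $u_iw_i\in E(G)$ for all $i\in\{1,\ldots,m\}$. ''Possibly empty'' means the graph with no vertices is allowed here. *)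

(* Defs.v *)
From mathcomp Require Import all_boot.

Set Implicit Arguments.
Unset Strict Implicit.
Unset Printing Implicit Defensive.

(* The vertex set may be empty: this is needed for the "possibly empty"
   two-set perfectly orderable graph. *)
Record sgraph : Type := SGraph {
  svertex :> finType;
  sedge : rel svertex;
  sedge_sym : symmetric sedge;
  sedge_irrefl : irreflexive sedge
}.

Definition neighbors (G : sgraph) (v : G) : {set G} := [set x | sedge v x].

(* One application of the skew color change rule, from the blue set B to the
   blue set B'.  The forcing vertex v may itself be blue or white. *)
Definition skew_force (G : sgraph) : rel {set G} :=
  fun B B' => [exists v : G, exists w : G,
    (neighbors v :\: B == [set w]) && (B' == w |: B)].

Definition skew_zero_forcing (G : sgraph) (S : {set G}) : bool :=
  connect (@skew_force G) S [set: G].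

(* Cardinalities of vertex sets range over 0, ..., #|G|, hence the index type
   'I_(#|G|.+1). *)
Definition skew_span (G : sgraph) : nat :=
  #|[set k : 'I_(#|G|.+1) | [exists Z : {set G}, exists F : {set G},
      [&& #|Z| == k, #|F| == k, skew_zero_forcing Z & ~~ skew_zero_forcing F]]]|.

(* The ordered sets U = {u_1, ..., u_m} and W = {w_1, ..., w_m} are injective
   enumerations u, w by 'I_m (indices shifted to 0, ..., m - 1). *)
Definition two_set_perfectly_orderable (G : sgraph) : Prop :=
  exists (m : nat) (u w : 'I_m -> G),
    [/\ injective u, injective w,
        [set u i | i : 'I_m] :&: [set w i | i : 'I_m] = set0
      & [set u i | i : 'I_m] :|: [set w i | i : 'I_m] = [set: G]] /\
    (forall (i : 'I_m) (v : G), sedge (u i) v ->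
       exists j : 'I_m, j <= i /\ v = w j) /\
    (forall i : 'I_m, sedge (u i) (w i)).

Definition isomorphic (G H : sgraph) : Prop :=
  exists f : G -> H, bijective f /\
    forall x y : G, sedge (f x) (f y) = sedge x y.

Definition union_edge (G H : sgraph) : rel (G + H)%type := fun a b =>
  match a, b with
  | inl x, inl y => sedge x y
  | inr x, inr y => sedge x y
  | _, _ => false
  end.

Lemma union_edge_sym (G H : sgraph) : symmetric (@union_edge G H).
Proof. by case=> x [] y //=; apply: sedge_sym. Qed.

Lemma union_edge_irrefl (G H : sgraph) : irreflexive (@union_edge G H).
Proof. by case=> x /=; apply: sedge_irrefl. Qed.

Definition disjoint_union (G H : sgraph) : sgraph :=
  SGraph (@union_edge_sym G H) (@union_edge_irrefl G H).

Definition single_vertex : sgraph :=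
  @SGraph unit (fun _ _ => false) (fun _ _ => erefl) (fun _ => erefl).

(* Main.v *)
(** Sizes 0 and n never contribute to the span, so it equals n - 1 iff every
    size 1, ..., n - 1 contributes.  Size n - 1 then yields an isolated vertex,
    and size 1 says that this vertex alone is a forcing set.  A set forces iff
    it meets every nonempty set X such that no vertex has exactly one neighbor
    in X.
    If the empty set forces a graph A, taking X = A shows that A has a leaf;
    deleting it together with its neighbor leaves a graph still forced by the
    empty set, and these leaf-neighbor pairs, in order of deletion, are the
    (u_i, w_i).  Conversely the u_i force the w_i in increasing order, after
    which the w_i force the u_i in decreasing order. *)
Require Import Defs.
From mathcomp Require Import all_boot.

(** * Obstructions to forcing *)

Definition isolated {G : sgraph} (v : G) : Prop := forall x, ~~ sedge v x.

(* Equivalent to: the empty set forces the subgraph induced on [A]. *)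
Definition self_forcing {G : sgraph} (A : {set G}) : Prop :=
  forall X : {set G}, X \subset A -> X != set0 ->
    exists2 y, y \in A & exists x, neighbors y :&: X = [set x].

(** Stated relative to a vertex subset of a fixed graph, so that deleting a pair only shrinks [A]
    and no induced subgraph has to be built during the induction. *)
Definition orderable_on {G : sgraph} (A : {set G}) {m : nat}
    (u w : 'I_m -> G) : Prop :=
  [/\ injective u, injective w,
      [set u i | i : 'I_m] :&: [set w i | i : 'I_m] = set0
    & [set u i | i : 'I_m] :|: [set w i | i : 'I_m] = A] /\
  (forall (i : 'I_m) (v : G), v \in A -> sedge (u i) v ->
     exists j : 'I_m, j <= i /\ v = w j) /\
  (forall i : 'I_m, sedge (u i) (w i)).

(** The first vertex of [X] to turn blue would be the only white neighbor of some vertex, hence its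
    only neighbor in [X], which is still white at that moment. *)
Lemma skew_force_sub {G : sgraph} {S T X : {set G}} :
  (forall y x, neighbors y :&: X <> [set x]) -> [disjoint S & X] ->
  connect (@skew_force G) S T -> [disjoint T & X].
Proof.
move=> fortX dSX /connectP[p]; elim: p S dSX => [|B p IHp] S dSX /=.
  by move=> _ ->.
case/andP=> /existsP[v /existsP[w /andP[/eqP NvS /eqP ->]]] path_p defT.
apply: IHp path_p defT; rewrite disjoints_subset subUset sub1set.
rewrite -disjoints_subset dSX inE andbT.
apply: contra_notN (fortX v w) => Xw; apply/setP=> z; rewrite !inE.
have /setP/(_ z) := NvS; rewrite !inE.
case: (z =P w) => [-> /andP[_ ->] // | _ NvSz].
apply: contraFF NvSz => /andP[-> Xz]; rewrite andbT.
by apply: contraTN Xz => Sz; rewrite (disjointFr dSX).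
Qed.

(** One direction is [skew_force_sub]. For the other, the condition applied to the set of all white
    vertices provides the next force, and it survives that force because a larger blue set is
    disjoint from fewer [X]. *)
Lemma skew_zero_forcingP {G : sgraph} (S : {set G}) :
  reflect (forall X : {set G}, [disjoint S & X] -> X != set0 ->
             exists y x, neighbors y :&: X = [set x])
          (skew_zero_forcing S).
Proof.
apply: (iffP idP) => [fS X dSX nX0 | ].
  have [/existsP[y /existsP[x /eqP e]]|] :=
    boolP [exists y, exists x, neighbors y :&: X == [set x]]; first by exists y, x.
  move=> /existsPn fortX; case/negP: nX0.
  have {}fortX y x : neighbors y :&: X <> [set x].
    by move/existsPn: (fortX y) => /(_ x)/eqP.
  by have := skew_force_sub fortX dSX fS; rewrite -setI_eq0 setTI.
have [n] := ubnP #|~: S|; elim: n S => // n IHn S leSn hS.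
have [S0|S0] := eqVneq (~: S) set0.
  by rewrite /skew_zero_forcing -(setCK S) S0 setC0 connect0.
have [|y [x Ny]] := hS (~: S) _ S0; first by rewrite -setI_eq0 setICr.
have Sx : x \in ~: S.
  by have := set11 x; rewrite -Ny inE => /andP[].
apply: connect_trans (connect1 _) (IHn (x |: S) _ _).
- by apply/existsP; exists y; apply/existsP; exists x; rewrite setDE Ny !eqxx.
- rewrite setCU setIC -setDE; move: leSn; rewrite (cardsD1 x) Sx.
  by rewrite add1n.
- move=> X; rewrite disjoints_subset subUset sub1set -disjoints_subset.
  by case/andP=> _; apply: hS.
Qed.

(** The sets disjoint from [[set v]] are the subsets of its complement, and the vertex [y] found for
    such a set is never [v], which has no neighbor. *)
Lemma self_forcing_compl1 {G : sgraph} {v : G} : isolated v ->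
  skew_zero_forcing [set v] <-> self_forcing (~: [set v]).
Proof.
move=> iso_v; split=> [/skew_zero_forcingP fv X sXv X0 | fv].
  have [|y [x Ny]] := fv X _ X0; first by rewrite disjoint_sym disjoints_subset.
  exists y; last by exists x.
  rewrite !inE; apply/eqP=> yv; have := set11 x; rewrite -Ny !inE yv.
  by rewrite (negPf (iso_v x)).
apply/skew_zero_forcingP=> X dvX X0.
have [|y _ [x Ny]] := fv X _ X0; last by exists y, x.
by rewrite -disjoints_subset disjoint_sym.
Qed.

(** * From self-forcing sets to orderings and back *)

(** The vertex that [fA] yields for [X] is not [u], whose only neighbor in [A] is [w], outside [X].
    If it is not [w] either, it survives the deletion; the remaining case applies [fA] a second
    time. *)
Lemma self_forcing_del_leaf {G : sgraph} (A : {set G}) (u w : G) :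
  self_forcing A -> u \in A -> neighbors u :&: A = [set w] ->
  self_forcing (A :\ u :\ w).
Proof.
move=> fA Au Nu X sXA X0.
have Xu x : x \in X -> [&& x != w, x != u & x \in A].
  by move/(subsetP sXA); rewrite !inE.
have sXA' : X \subset A by apply/subsetP=> x /Xu/and3P[].
have wNu x : x \in A -> sedge u x -> x = w.
  by move=> Ax ux; apply/set1P; rewrite -Nu !inE ux.
have uw : sedge u w by have := set11 w; rewrite -Nu !inE => /andP[].
have no_u x : x \in A -> x != w -> ~~ sedge u x.
  by move=> Ax; apply: contra => /(wNu _ Ax)->.
have [y Ay [x Ny]] := fA X sXA' X0.
have : x \in neighbors y :&: X by rewrite Ny set11.
rewrite !inE => /andP[yx Xx]; have /and3P[xw xu Ax] := Xu x Xx.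
have yu : y != u by apply: contraTneq yx => ->; apply: no_u.
have [yw|yw] := eqVneq y w; last by exists y; [rewrite !inE yw yu | exists x].
(* Only the deleted vertex [w] was found for [X]; it has two neighbors in
   [u |: X], so that set yields another vertex, which does not see [u]. *)
have [| |z Az [t Nz]] := fA (u |: X).
- by rewrite subUset sub1set Au.
- by apply/set0Pn; exists u; rewrite setU11.
have : t \in neighbors z :&: (u |: X) by rewrite Nz set11.
rewrite !inE => /andP[zt uXt].
have zw : z != w.
  apply: contraNneq xu => zw; apply/eqP; transitivity t.
    by apply/set1P; rewrite -Nz !inE Xx orbT zw -yw yx.
  by apply/esym/set1P; rewrite -Nz !inE eqxx zw sedge_sym uw.
have zu : ~~ sedge z u by rewrite sedge_sym no_u.
have tu : t != u by apply: contraTneq zt => ->.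
rewrite (negPf tu) /= in uXt; have /and3P[tw _ At] := Xu t uXt.
exists z.
  by rewrite !inE zw Az andbT /=; apply: contraTneq zt => ->; apply: no_u.
exists t; rewrite -Nz; apply/setP=> s; rewrite !inE.
by case: eqP => [-> | _ //]; rewrite (negPf zu).
Qed.

Lemma self_forcing_orderable_on {G : sgraph} (A : {set G}) :
  self_forcing A -> exists m (u w : 'I_m -> G), orderable_on A u w.
Proof.
have [n] := ubnP #|A|; elim: n A => // n IHn A leAn fA.
have [->|A0] := eqVneq A set0.
  pose e (i : 'I_0) : G := match notF (ltn_ord i) with end.
  exists 0, e, e; split; last by split; case.
  split; try by case.
  - by apply/setP=> x; rewrite !inE; apply/andP=> -[/imsetP[[]]].
  - by apply/setP=> x; rewrite !inE; apply/orP=> -[] /imsetP[[]].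
have [x Ax [y Nx]] := fA A (subxx A) A0.
have /andP[xy Ay] : sedge x y && (y \in A).
  by have := set11 y; rewrite -Nx !inE.
have xNy : x != y by apply: contraTneq xy => ->; rewrite sedge_irrefl.
have Nxy z : z \in A -> sedge x z -> z = y.
  by move=> Az xz; apply/set1P; rewrite -Nx !inE xz.
have [||m [u [w [[inj_u inj_w uw0 uwA] [Nu uw]]]]] := IHn (A :\ x :\ y).
- apply: leq_trans (_ : #|A| <= n); last by rewrite -ltnS.
  by rewrite ltnS in leAn; rewrite (cardsD1 x A) Ax ltnS subset_leq_card ?subD1set.
- exact: self_forcing_del_leaf fA Ax Nx.
have A'u i : u i \in A :\ x :\ y by rewrite -uwA inE imset_f.
have A'w i : w i \in A :\ x :\ y by rewrite -uwA inE imset_f ?orbT.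
(* The new pair takes index 0 and the others shift up: [x] sees only [y] in [A], while a later [u i]
   may see [y] but not [x]. *)
pose ext (a : G) (f : 'I_m -> G) (i : 'I_m.+1) := oapp f a (unlift ord0 i).
have ext0 a f : ext a f ord0 = a by rewrite /ext unlift_none.
have extS a f i : ext a f (lift ord0 i) = f i by rewrite /ext liftK.
have inj_ext a f : (forall i, f i != a) -> injective f -> injective (ext a f).
  move=> faN inj_f i j.
  case: (unliftP ord0 i) => [i'|] ->; case: (unliftP ord0 j) => [j'|] ->;
    rewrite ?ext0 ?extS // => e.
  - by rewrite (inj_f _ _ e).
  - by case/eqP: (faN i').
  - by case/eqP: (faN j').
have im_ext a f : [set ext a f i | i : 'I_m.+1] = a |: [set f i | i : 'I_m].
  apply/setP=> z; rewrite !inE; apply/imsetP/predU1P => [[i _ ->] | ].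
    by case: (unliftP ord0 i) => [i'|] ->; rewrite ?ext0 ?extS;
      [right; apply: imset_f | left].
  case=> [-> | /imsetP[i _ ->]]; first by exists ord0; rewrite ?ext0.
  by exists (lift ord0 i); rewrite ?extS.
exists m.+1, (ext x u), (ext y w); split; [split | split].
- by apply: inj_ext inj_u => i; have := A'u i; rewrite !inE => /and3P[].
- by apply: inj_ext inj_w => i; have := A'w i; rewrite !inE => /and3P[].
- rewrite !im_ext; apply/setP=> z; have /setP/(_ z) := uw0; rewrite !inE.
  have /setP/(_ z) := uwA; rewrite !inE.
  case: (z =P x) => [-> | _] /=.
    by rewrite (negPf xNy) andbF => /negbT/norP[_ /negPf->].
  by case: (z =P y) => [-> | _] //= /negbT/norP[/negPf->].
- rewrite !im_ext; apply/setP=> z; have /setP/(_ z) := uwA; rewrite !inE.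
  case: (z =P x) => [-> | _] /=; first by rewrite Ax.
  by case: (z =P y) => [-> | _] /=; first by rewrite orbT Ay.
- move=> i v Av; case: (unliftP ord0 i) => [i'|] ->; rewrite ?ext0 ?extS => uv.
    have [-> | vy] := eqVneq v y; first by exists ord0; rewrite ext0.
    have [vx | vx] := eqVneq v x.
      (* An edge between [u i'] and [x] would make [u i'] equal to [y], which has been deleted. *)
      have := A'u i'; rewrite !inE => /and3P[uiy _ Aui]; case/eqP: uiy.
      by apply: Nxy Aui _; rewrite -vx sedge_sym.
    have [||j [leji ->]] := Nu i' v; rewrite ?inE ?vy ?vx //.
    by exists (lift ord0 j); rewrite extS.
  by exists ord0; rewrite ext0; split=> //; apply: Nxy.
- by move=> i; case: (unliftP ord0 i) => [i'|] ->; rewrite ?ext0 ?extS.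
Qed.

(** If no vertex of [A] had exactly one neighbor in [X], the vertices [u i] would exclude every
    [w i] from [X], and then the [w i] every [u i], leaving [X] empty. *)
Lemma orderable_on_self_forcing {G : sgraph} (A : {set G}) m (u w : 'I_m -> G) :
  orderable_on A u w -> self_forcing A.
Proof.
case=> [[inj_u inj_w _ uwA] [Nu uw]] X sXA X0.
have Au i : u i \in A by rewrite -uwA inE imset_f.
have Aw i : w i \in A by rewrite -uwA inE imset_f ?orbT.
have [/exists_inP[y Ay /existsP[x /eqP Ny]]|] :=
  boolP [exists y in A, exists x, neighbors y :&: X == [set x]].
  by exists y => //; exists x.
move=> /exists_inPn fortX; case/negP: X0.
have {}fortX y x : y \in A -> neighbors y :&: X <> [set x].
  by move=> /fortX/existsPn/(_ x)/eqP.
(* Upward induction: within [A], [u i] sees only [w j] with [j <= i], and those with [j < i] are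
   already outside [X]. *)
have wNX i : w i \notin X.
  have [k] := ubnP i; elim: k i => // k IHk i lt_ik.
  apply/negP=> Xwi; apply: (fortX (u i) (w i) (Au i)).
  apply/setP=> z; rewrite !inE; apply/andP/eqP=> [[uz Xz] | ->]; last by [].
  have [j [leji zj]] := Nu i z (subsetP sXA z Xz) uz.
  move: leji; rewrite leq_eqVlt => /orP[/eqP/val_inj <- // | ltji].
  by case/negP: (IHk j (leq_trans ltji lt_ik)); rewrite -zj.
(* Downward induction: the neighbors of [w i] in [X] can only be some [u j], with [i <= j] by the
   ordering, and those with [i < j] are already outside [X]. *)
have uNX i : u i \notin X.
  have [k] := ubnP (m - i); elim: k i => // k IHk i lt_ik.
  apply/negP=> Xui; apply: (fortX (w i) (u i) (Aw i)).
  apply/setP=> z; rewrite !inE; apply/andP/eqP=> [[wz Xz] | ->]; last first.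
    by rewrite sedge_sym.
  have := subsetP sXA z Xz; rewrite -uwA inE => /orP[] /imsetP[j _ zj]; last first.
    by case/negP: (wNX j); rewrite -zj.
  rewrite zj sedge_sym in wz; have [l [lelj /inj_w il]] := Nu j _ (Aw i) wz.
  move: lelj; rewrite -il leq_eqVlt => /orP[/eqP/val_inj-> // | ltij].
  suff /negP[] : u j \notin X by rewrite -zj.
  by apply: IHk; apply: leq_trans (ltn_sub2l (ltn_ord i) ltij) lt_ik.
apply/set0Pn=> -[z Xz]; have := subsetP sXA z Xz.
rewrite -uwA inE => /orP[] /imsetP[j _ zj].
  by case/negP: (uNX j); rewrite -zj.
by case/negP: (wNX j); rewrite -zj.
Qed.

(** * Splitting off an isolated vertex *)

Lemma single_vertex_decomposition (G : sgraph) :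
  (exists H : sgraph, two_set_perfectly_orderable H /\
     isomorphic G (disjoint_union H single_vertex)) <->
  (exists v : G, isolated v /\
     exists m (u w : 'I_m -> G), orderable_on (~: [set v]) u w).
Proof.
split=> [[H [[m [u [w [[inj_u inj_w uw0 uwH] [Nu uw]]]]]] [f [[g fK gK] fE]]] |].
  have inj_g : injective g := can_inj gK.
  have gE a b : sedge (g a) (g b) = union_edge a b by rewrite -fE !gK.
  pose gl (a : H) : G := g (inl a).
  have inj_gl : injective gl by move=> a b /inj_g[].
  exists (g (inr tt)); split=> [x|].
    by rewrite -(fK x) gE; case: (f x).
  have im_gl (h : 'I_m -> H) : [set (gl \o h) i | i : 'I_m]
      = gl @: [set h i | i : 'I_m] by exact: (imset_comp gl h).
  exists m, (gl \o u), (gl \o w); split; [split | split].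
  - exact: inj_comp.
  - exact: inj_comp.
  - by rewrite !im_gl -imsetI ?uw0 ?imset0 // => a b _ _; apply: inj_gl.
  - rewrite !im_gl -imsetU uwH; apply/setP=> x; rewrite !inE.
    rewrite -(fK x) (inj_eq inj_g); case: (f x) => [a|[]].
      by rewrite (mem_imset _ _ inj_gl) inE.
    by rewrite eqxx; apply/negbTE/imsetP=> -[a _ /inj_g].
  - move=> i x _ /=; rewrite -(fK x) gE; case: (f x) => //= a /Nu[j [leji ->]].
    by exists j.
  - by move=> i /=; rewrite gE; apply: uw.
case=> v [iso_v [m [u [w [[inj_u inj_w uw0 uwA] [Nu uw]]]]]].
have nv x : (x \in ~: [set v]) = (x != v) by rewrite !inE.
have uv i : u i != v by rewrite -nv -uwA inE imset_f.
have wv i : w i != v by rewrite -nv -uwA inE imset_f ?orbT.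
(* The graph [H] is induced on the vertices other than [v]. Below, [insub] fails exactly at [v],
   which is thus sent to the single vertex. *)
pose V := {x : G | x != v}.
pose H := @SGraph V (fun x y => sedge (val x) (val y))
  (fun x y => sedge_sym _ _) (fun x => sedge_irrefl _).
pose u' i : H := Sub (u i) (uv i); pose w' i : H := Sub (w i) (wv i).
exists H; split.
  exists m, u', w'; split; [split | split].
  - by move=> i j /(congr1 val); apply: inj_u.
  - by move=> i j /(congr1 val); apply: inj_w.
  - apply/setP=> x; rewrite !inE; apply/andP=> -[/imsetP[i _ ->] /imsetP[j _]].
    move/(congr1 val) => /= uiwj.
    have /setP/(_ (u i)) := uw0.
    by rewrite !inE imset_f // uiwj imset_f.
  - apply/setP=> x; rewrite !inE.
    have := valP x; rewrite -nv -uwA inE.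
    by case/orP=> /imsetP[i _ xi]; apply/orP; [left | right];
      apply/imsetP; exists i => //; apply: val_inj.
  - move=> i x /= ux; have [|j [leji xj]] := Nu i (val x) _ ux.
      by rewrite nv (valP x).
    by exists j; split=> //; apply: val_inj.
  - by move=> i; apply: uw.
pose f (x : G) : disjoint_union H single_vertex :=
  if insub x is Some y then inl y else inr tt.
pose g (a : disjoint_union H single_vertex) : G :=
  if a is inl y then val y else v.
exists f; split.
  exists g => [x | [y | []]]; rewrite /f /g ?valK //.
    by case: insubP => //= /negPn/eqP.
  by rewrite insubF ?eqxx.
move=> x y; rewrite /f.
case: insubP => [x' _ <- | /negPn/eqP->]; case: insubP => [y' _ <- | /negPn/eqP->] //=.
- by rewrite sedge_sym (negPf (iso_v _)).
- by rewrite (negPf (iso_v _)).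
- by rewrite (negPf (iso_v _)).
Qed.

(** * Sizes that contribute to the span *)

Lemma skew_zero_forcing_full {G : sgraph} : skew_zero_forcing [set: G].
Proof. exact: connect0. Qed.

Lemma skew_zero_forcing_mono {G : sgraph} {S T : {set G}} :
  S \subset T -> skew_zero_forcing S -> skew_zero_forcing T.
Proof.
move=> sST /skew_zero_forcingP fS; apply/skew_zero_forcingP=> X dTX.
exact: fS (disjointWl sST dTX).
Qed.

Lemma isolated_mem_skew_zero_forcing {G : sgraph} {v : G} {S : {set G}} :
  isolated v -> skew_zero_forcing S -> v \in S.
Proof.
move=> iso_v /skew_zero_forcingP fS; apply/negPn/negP=> Sv.
have [||y [x Ny]] := fS [set v]; last 1 first.
- have := set11 x; rewrite -Ny !inE => /andP[yx /eqP xv].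
  by case/negP: (iso_v y); rewrite sedge_sym -xv.
- by rewrite disjoint_sym disjoints_subset sub1set inE.
- by apply/set0Pn; exists v; rewrite set11.
Qed.

(** The neighbor [x] forces [v], the only white vertex. Contrapositively, a non-forcing set of size
    n - 1 misses an isolated vertex. *)
Lemma skew_zero_forcing_compl1 {G : sgraph} {v x : G} :
  sedge v x -> skew_zero_forcing (~: [set v]).
Proof.
move=> vx; apply/skew_zero_forcingP=> X dX X0; exists x, v.
have sXv : X \subset [set v].
  by rewrite -(setCK [set v]) -disjoints_subset disjoint_sym.
have -> : X = [set v] by apply/eqP; rewrite eqEsubset sXv sub1set;
  have /set0Pn[z Xz] := X0; have /set1P <- := subsetP sXv z Xz.
by apply/setP=> z; rewrite !inE; case: eqP => [->|]; rewrite ?andbF // sedge_sym vx.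
Qed.

(** Only one set has size 0 and only one has size n, so at these sizes [Z] and [F] would
    coincide. *)
Lemma skew_span_index_bound (G : sgraph) (k : 'I_(#|G|.+1)) (Z F : {set G}) :
  #|Z| = k -> #|F| = k -> skew_zero_forcing Z -> ~~ skew_zero_forcing F ->
  k \in ~: [set ord0; ord_max].
Proof.
move=> Zk Fk fZ nF; rewrite !inE negb_or; apply/andP; split.
  apply: contraNneq nF => k0; move: Zk Fk; rewrite k0 => /cards0_eq Z0 /cards0_eq ->.
  by rewrite -Z0.
apply: contraNneq nF => kn; suff -> : F = [set: G] by apply: skew_zero_forcing_full.
by apply/eqP; rewrite eqEcard subsetT cardsT Fk kn leqnn.
Qed.

Lemma subset_of_card {T : finType} {A : {set T}} {k : nat} :
  k <= #|A| -> exists2 B : {set T}, B \subset A & #|B| = k.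
Proof.
rewrite -bin_gt0 -cards_draws card_gt0 => /set0Pn[B].
by rewrite inE => /andP[sBA /eqP Bk]; exists B.
Qed.

Lemma skew_span_maximal (G : sgraph) : 0 < #|G| ->
  (skew_span G = #|G| - 1 <->
     exists v : G, isolated v /\ skew_zero_forcing [set v]) /\
  skew_span G <= #|G| - 1.
Proof.
move=> G_gt0; rewrite /skew_span; set K := [set k | _].
set D : {set 'I_(#|G|.+1)} := ~: [set ord0; ord_max].
(* As [G] is nonempty, 0 and n are distinct indices, so exactly n - 1 of the n + 1 remain. *)
have cardD : #|D| = #|G| - 1.
  have := cardsC [set ord0; ord_max : 'I_(#|G|.+1)]; rewrite card_ord cards2 -/D.
  have -> : ord0 != ord_max :> 'I_(#|G|.+1) by rewrite -val_eqE /= eq_sym -lt0n.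
  by rewrite add2n => -[cardD]; rewrite -[in RHS]cardD subn1.
have sKD : K \subset D.
  apply/subsetP=> k; rewrite inE => /existsP[Z /existsP[F]].
  by case/and4P=> /eqP Zk /eqP Fk; apply: skew_span_index_bound Zk Fk.
split; last by rewrite -cardD subset_leq_card.
rewrite -cardD; split=> [cardK | [v [iso_v fv]]]; last first.
  apply/eqP; rewrite eqn_leq subset_leq_card // subset_leq_card //.
  apply/subsetP=> k; rewrite !inE negb_or -!val_eqE /= => /andP[k_neq0 k_neqn].
  have k_le : k <= #|~: [set v]|.
    by rewrite cardsC1 -ltnS prednK // ltn_neqAle k_neqn -ltnS ltn_ord.
  (* Two sets of size [k]: [F] avoids the isolated [v] and so does not force, while [v] joined to
     [k.-1] other vertices does. *)
  have [F sF Fk] := subset_of_card k_le.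
  have [B sB Bk] := subset_of_card (leq_trans (leq_pred k) k_le).
  have F'v : v \notin F by have := subsetP sF v; rewrite !inE eqxx => /contraNN->.
  have B'v : v \notin B by have := subsetP sB v; rewrite !inE eqxx => /contraNN->.
  apply/existsP; exists (v |: B); apply/existsP; exists F.
  rewrite Fk cardsU1 B'v Bk add1n prednK ?lt0n // !eqxx /=.
  rewrite (skew_zero_forcing_mono (subsetUl _ _) fv) /=.
  by apply: contraNN F'v => /(isolated_mem_skew_zero_forcing iso_v).
have KD : K = D by apply/eqP; rewrite eqEcard sKD cardK leqnn.
(* For n = 1 the set [D] is empty and yields nothing, but the only vertex is isolated and makes up
   the whole graph. *)
have [n1 | n_gt1] := leqP #|G| 1.
  have /card_gt0P[v _] := G_gt0.
  have allv (x : G) : x = v by apply: (fintype_le1P n1).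
  exists v; split=> [x|]; first by rewrite (allv x) sedge_irrefl.
  suff -> : [set v] = [set: G] by apply: skew_zero_forcing_full.
  by apply/setP=> x; rewrite !inE (allv x) eqxx.
have lt1 : 1 < #|G|.+1 by apply: ltnW.
have : Ordinal lt1 \in K.
  by rewrite KD !inE negb_or -!val_eqE /= neq_ltn n_gt1.
rewrite inE => /existsP[Z /existsP[_ /and4P[/cards1P[v defZ] _ fZ _]]].
(* Size 1 has provided a forcing singleton; size n - 1 now provides a non-forcing set, whose missing
   vertex [x] must be isolated. *)
have ltn1 : #|G| - 1 < #|G|.+1 by rewrite subn1 ltnS leq_pred.
have : Ordinal ltn1 \in K.
  rewrite KD !inE negb_or -!val_eqE /= -lt0n subn_gt0 n_gt1.
  by rewrite neq_ltn ltn_subrL G_gt0.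
rewrite inE => /existsP[_ /existsP[F /and4P[_ /eqP cardF _ nF]]].
have /cards1P[x defF] : #|~: F| == 1 by rewrite cardsCs setCK cardF subKn.
have iso_x : isolated x.
  move=> y; apply: contraNN nF => xy.
  by rewrite -(setCK F) defF (skew_zero_forcing_compl1 xy).
(* Every forcing set contains the isolated [x], so the forcing singleton is [[set x]]. *)
exists x; split=> //.
by have := isolated_mem_skew_zero_forcing iso_x fZ; rewrite defZ => /set1P->;
  rewrite -defZ.
Qed.

Theorem theorem18 (G : sgraph) (n : nat) (hn : 1 <= n) (hG : #|G| = n) :
  (skew_span G = n - 1 <->
     exists H : sgraph, two_set_perfectly_orderable H /\
       isomorphic G (disjoint_union H single_vertex)) /\
  skew_span G <= n - 1.
Proof.
rewrite -hG in hn *; have [span_max span_le] := skew_span_maximal G hn.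
split=> //; apply: (iff_trans span_max).
apply: iff_sym; apply: (iff_trans (single_vertex_decomposition G)).
split=> -[v [iso_v hv]]; exists v; split=> //.
  apply/(self_forcing_compl1 iso_v); have [m [u [w ouw]]] := hv.
  exact: orderable_on_self_forcing ouw.
by apply/self_forcing_orderable_on/(self_forcing_compl1 iso_v).
Qed.
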